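(* Let $q,d\in\mathbb{N}$ be odd numbers and let $f_{q,d}:\mathbb{N}\to\mathbb{N}$ be the $qx+d$-function, i.e. $f_{q,d}(n)=qn+d$ if $n$ is odd and $f_{q,d}(n)=n/2$ if $n$ is even. Suppose that $x\in\mathbb{N}$ is a periodic point of $f_{q,d}$ and that $m\in\mathbb{N}$ is the minimum positive integer such that $f_{q,d}^m(x)=x$. For $1\le j\le m$ define $$i_j=\begin{cases}1, & f_{q,d}^{j-1}(x) \text{ odd},\\ 2, & f_{q,d}^{j-1}(x)\text{ even}.\end{cases}$$ Then $I=(i_1,i_2,\dots,i_m)$ is aperiodic. In particular, if $n\in\mathbb{N}$ is a periodic point of the Collatz map $f$ (that is, $f=f_{3,1}$) and $m\in\mathbb{N}$ is the minimum positive integer such that $f^m(n)=n$, then the $m$-tuple $$\big((-1)^n,(-1)^{f(n)},\dots,(-1)^{f^{m-1}(n)}\big)$$ is aperiodic.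
   Context: $\mathbb{N}$ is the set of positive integers; $f^m$ is the $m$-th iterate of $f$ ($f^0=\mathrm{id}$). A point $x$ is a periodic point of $f$ if $f^m(x)=x$ for some $m\in\mathbb{N}$. Aperiodic tuple: let $\sigma$ be the cyclic permutation $1\mapsto2\mapsto\cdots\mapsto m\mapsto1$ of $\{1,\dots,m\}$. An $m$-tuple of numbers $(i_1,\dots,i_m)$ is aperiodic if $(i_{\sigma^j(1)},\dots,i_{\sigma^j(m)})\ne(i_1,\dots,i_m)$ for every $1\le j<m$. *)

(* Defs.v *)
From mathcomp Require Import all_boot.

Set Implicit Arguments.
Unset Strict Implicit.
Unset Printing Implicit Defensive.

(* The positive integers are represented by the [n : nat] with [0 < n]; by
   [qxd_gt0] below, [qxd q d] restricts to a self-map of them. *)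
Definition qxd (q d n : nat) : nat := if odd n then q * n + d else n./2.

Lemma qxd_gt0 (q d n : nat) : odd d -> 0 < n -> 0 < qxd q d n.
Proof.
move=> d_odd n_gt0; rewrite /qxd; case: ifPn => [_|n_even].
  by rewrite addn_gt0 (odd_gt0 d_odd) orbT.
by rewrite half_gt0; case: n n_gt0 n_even => [|[|n]].
Qed.

Definition collatz : nat -> nat := qxd 3 1.

Definition periodic_point (T : Type) (f : T -> T) (x : T) : Prop :=
  exists m : nat, 0 < m /\ iter m f x = x.

Definition minimal_period (T : Type) (f : T -> T) (x : T) (m : nat) : Prop :=
  [/\ 0 < m, iter m f x = x
    & forall k : nat, 0 < k -> iter k f x = x -> m <= k].

(* Positions are numbered from 0: the cyclic permutation
   1 |-> 2 |-> ... |-> m |-> 1 becomes [@ordS m], i.e. k |-> k.+1 %% m. *)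
Definition aperiodic (T : Type) (m : nat) (t : m.-tuple T) : Prop :=
  forall j : nat, 1 <= j < m ->
    [tuple tnth t (iter j (@ordS m) k) | k < m] <> t.

Definition parity_code (n : nat) : nat := if odd n then 1 else 2.

(* Main.v *)
Require Import Defs.
From mathcomp Require Import all_boot all_order all_algebra.

(** The parities along the whole forward orbit determine the starting point:
    two points whose orbits have equal parities for ever are congruent modulo
    every power of 2, since each halving step (at least one in any two
    consecutive steps) gains a factor 2, while an odd step multiplies the
    difference by the odd number [q].  If the cyclic parity word of [x] is
    invariant under a shift by [j], then [x] and its [j]-th iterate have the
    same parities for ever, hence coincide. *)

Lemma iter_modn (T : Type) (f : T -> T) (x : T) (m k : nat) :
  iter m f x = x -> iter (k %% m) f x = iter k f x.
Proof.
move=> fmx; rewrite {2}(divn_eq k m) addnC iterD; congr iter.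
by elim: (k %/ m) => //= n IHn; rewrite mulSn iterD -IHn.
Qed.

Lemma val_iter_ordS (m j : nat) (k : 'I_m) :
  iter j (@ordS m) k = (k + j) %% m :> nat.
Proof.
elim: j => [|j IHj]; first by rewrite addn0 modn_small.
by rewrite iterS /= IHj -addn1 modnDml addn1 addnS.
Qed.

Lemma eqn_mod_double (N x y : nat) :
  (x.*2 == y.*2 %[mod 2 ^ N.+1]) = (x == y %[mod 2 ^ N]).
Proof. by rewrite -!mul2n expnS -!muln_modr eqn_pmul2l. Qed.

Lemma eqn_mod_coprime_mull (n q x y : nat) : coprime n q ->
  (q * x == q * y %[mod n]) = (x == y %[mod n]).
Proof.
(* Ordering [x] and [y] makes the truncated difference exact, so the congruence becomes divisibility
   of [q * (x - y)] and Gauss's lemma removes [q]. *)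
move=> co_nq; wlog le_yx : x y / y <= x => [IH|].
  by case/orP: (leq_total y x) => /IH // eqxy; rewrite eq_sym eqxy eq_sym.
by rewrite !eqn_mod_dvd ?leq_mul2l ?le_yx ?orbT // -mulnBr Gauss_dvdr.
Qed.

Section ParitySequence.

Variables q d : nat.
Hypotheses (q_odd : odd q) (d_odd : odd d).

Definition same_parities (x y : nat) : Prop :=
  forall k, odd (iter k (qxd q d) x) = odd (iter k (qxd q d) y).

Lemma same_parities_qxd (x y : nat) :
  same_parities x y -> same_parities (qxd q d x) (qxd q d y).
Proof. by move=> xy k; rewrite -!iterSr. Qed.

Lemma qxd_parities_eqn_mod (N x y : nat) :
  same_parities x y -> x == y %[mod 2 ^ N].
Proof.
elim: N x y => [|N IHN] x y xy; first by rewrite !modn1.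
have even_case u v : same_parities u v -> ~~ odd u -> u == v %[mod 2 ^ N.+1].
  move=> uv u_even; have v_even : ~~ odd v by rewrite -(uv 0).
  rewrite -(even_halfK u_even) -(even_halfK v_even) eqn_mod_double.
  have := IHN _ _ (same_parities_qxd _ _ uv).
  by rewrite /qxd (negPf u_even) (negPf v_even).
case: (boolP (odd x)) => [x_odd | /even_case]; last exact.
have y_odd : odd y by rewrite -(xy 0).
(* Both images are even because [q] and [d] are odd, so [even_case] applies to them at the same
   exponent [N.+1]; cancelling [d] and the odd factor [q] loses no power of 2. *)
have := even_case _ _ (same_parities_qxd _ _ xy).
rewrite /qxd x_odd y_odd oddD oddM q_odd x_odd d_odd => /(_ isT).
by rewrite eqn_modDr eqn_mod_coprime_mull // coprimeXl // coprime2n.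
Qed.

Lemma qxd_parities_inj (x y : nat) :
  same_parities x y -> x = y.
Proof.
(* With this exponent both numbers lie below the modulus, so congruence is equality. *)
move/(qxd_parities_eqn_mod (maxn x y)).
have lt_exp z : z <= maxn x y -> z < 2 ^ maxn x y.
  by move/leq_ltn_trans; apply; exact: ltn_expl.
by rewrite !modn_small ?lt_exp ?leq_maxl ?leq_maxr // => /eqP.
Qed.

(** An arbitrary code [g] that determines parity serves both the 1/2 coding and the signs. *)
Lemma aperiodic_qxd_code (T : Type) (g : nat -> T) (x m : nat) :
  (forall a b, g a = g b -> odd a = odd b) ->
  minimal_period (qxd q d) x m ->
  aperiodic [tuple g (iter k (qxd q d) x) | k < m].
Proof.
move=> g_odd [m_gt0 fmx m_min] j /andP[j_gt0 lt_jm] shift_eq.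
suff /(m_min j j_gt0) : iter j (qxd q d) x = x by rewrite leqNgt lt_jm.
apply: qxd_parities_inj => k; apply: g_odd.
(* Entry [k %% m] suffices for every [k]: by periodicity it compares the iterates of order [k + j]
   and [k]. *)
have := congr1 (fun t => tnth t (Ordinal (ltn_pmod k m_gt0))) shift_eq.
by rewrite !tnth_mktuple val_iter_ordS /= modnDml !iter_modn // iterD.
Qed.

End ParitySequence.

Theorem corollary3p5 :
  (forall (q d : nat), odd q -> odd d ->
   forall (x : nat), 0 < x -> periodic_point (qxd q d) x ->
   forall (m : nat), minimal_period (qxd q d) x m ->
     aperiodic [tuple parity_code (iter k (qxd q d) x) | k < m])
  /\
  (forall (n : nat), 0 < n -> periodic_point collatz n ->
   forall (m : nat), minimal_period collatz n m ->
     aperiodic [tuple ((-1 : int) ^+ iter k collatz n)%R | k < m]).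
Proof.
split=> [q d q_odd d_odd x _ _ m | n _ _ m].
  apply: aperiodic_qxd_code => // a b.
  by rewrite /parity_code; do 2!case: odd.
apply: (@aperiodic_qxd_code 3 1 _ _ _ (fun a => ((-1 : int) ^+ a)%R)) => // a b.
by rewrite -GRing.signr_odd -[RHS]GRing.signr_odd; do 2!case: odd.
Qed.
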